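(* Let $s,t$ be integers with $s=3^as'$ and $t=3^bt'$, where $a,b$ are positive integers, $s',t'$ are integers with $3\nmid s't'$, and $b=2a-1$. Let $(P_n)_{n\ge1}$ be the sequence of Lucas atoms associated with $(s,t)$. Then for each $n\ge 2$, \[ v_3(P_n)=\begin{cases} a & \text{if } n=2,\\ b+1+v_3(s'^2+t') & \text{if } n=6,\\ 3^{h-1}b+1 & \text{if } n=2\cdot 3^h \text{ for some integer } h\ge 2,\\ b\,\dfrac{\varphi(n)}{2} & \text{otherwise.}\end{cases} \]
   Context: Lucas atoms: for $n\ge 1$ let $\Phi_n(\alpha,\beta)=\prod_{1\le j\le n,\ \gcd(j,n)=1}(\alpha-\omega^j\beta)$, with $\omega$ a primitive $n$-th root of unity (the homogenization of the $n$-th cyclotomic polynomial). Put $P_1(s,t)=1$, and for $n\ge 2$ let $P_n(s,t)\in\mathbb Z[s,t]$ be the unique polynomial with $P_n(\alpha+\beta,-\alpha\beta)=\Phi_n(\alpha,\beta)$ as polynomials in the variables $\alpha,\beta$. For integers $s,t$, $P_n$ denotes the integer value $P_n(s,t)$. $v_3$ is the $3$-adic valuation, with $v_3(0)=+\infty$; $\varphi$ is Euler's totient function. *)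

(* Defs.v *)
From mathcomp Require Import all_boot all_order all_fingroup all_algebra all_field.
From mathcomp Require Import mpoly constructive_ereal.

Set Implicit Arguments.
Unset Strict Implicit.
Unset Printing Implicit Defensive.

Import Order.TTheory GRing.Theory Num.Theory.
Local Open Scope ring_scope.

(* The variables 'X_0 and 'X_1 stand for alpha and beta. *)
Definition hcyclotomic (w : algC) (n : nat) : {mpoly algC[2]} :=
  \prod_(1 <= j < n.+1 | coprime j n) ('X_0 - w ^+ j *: 'X_1).

(* In P the variables 'X_0 and 'X_1 stand for s and t; the identity lives in
   algC[alpha, beta], since the individual factors of Phi_n are not integral. *)
Definition lucas_atom_spec (n : nat) (P : {mpoly int[2]}) : Prop :=
  forall w : algC, n.-primitive_root w ->
    map_mpoly intr P \mPo [tuple 'X_0 + 'X_1; - ('X_0 * 'X_1)]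
      = hcyclotomic w n.

Lemma comp_mpolyA (n k l : nat) (R : comNzRingType) (p : {mpoly R[n]})
    (u : n.-tuple {mpoly R[k]}) (v : k.-tuple {mpoly R[l]}) :
  (p \mPo u) \mPo v = p \mPo [tuple tnth u i \mPo v | i < n].
Proof.
rewrite !(comp_mpolyEX p) raddf_sum /=; apply/eq_bigr => m _.
rewrite comp_mpolyZ !comp_mpolyX rmorph_prod /=; congr (_ *: _).
by apply/eq_bigr=> i _; rewrite rmorphXn tnth_mktuple.
Qed.

Lemma eq_tuple2 (T : Type) (f : 'I_2 -> T) : [tuple f i | i < 2] = [tuple f 0; f 1].
Proof.
apply: eq_from_tnth => i; rewrite tnth_mktuple.
by case: i => [[|[|//]] ?] //=; rewrite (tnth_nth (f 0)) /=; congr f; apply/val_inj.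
Qed.

Lemma comp2A (R : comNzRingType) (p : {mpoly R[2]}) (u0 u1 v0 v1 : {mpoly R[2]}) :
  (p \mPo [tuple u0; u1]) \mPo [tuple v0; v1]
    = p \mPo [tuple u0 \mPo [tuple v0; v1]; u1 \mPo [tuple v0; v1]].
Proof. by rewrite comp_mpolyA eq_tuple2. Qed.

Lemma mesym2E (R : comNzRingType) :
  [tuple mesym 2 R i.+1 | i < 2] = [tuple 'X_0 + 'X_1; 'X_0 * 'X_1].
Proof.
have e1 : lift ord0 ord0 = 1 :> 'I_2 by apply/val_inj.
by rewrite eq_tuple2 mesym1E mesymnnE !big_ord_recl !big_ord0 addr0 mulr1 e1.
Qed.

Lemma comp2_neg_id (R : comNzRingType) (p : {mpoly R[2]}) :
  (p \mPo [tuple 'X_0; - 'X_1]) \mPo [tuple 'X_0; - 'X_1] = p.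
Proof.
rewrite comp2A comp_mpolyN !comp_mpolyXU /= opprK -[RHS]comp_mpoly_id.
by rewrite eq_tuple2.
Qed.

Lemma comp2_neg_esym (R : comNzRingType) (p : {mpoly R[2]}) :
  (p \mPo [tuple 'X_0; - 'X_1]) \mPo [tuple 'X_0 + 'X_1; 'X_0 * 'X_1]
    = p \mPo [tuple 'X_0 + 'X_1; - ('X_0 * 'X_1)] :> {mpoly R[2]}.
Proof. by rewrite comp2A comp_mpolyN !comp_mpolyXU. Qed.

Lemma map_comp2 (P : {mpoly int[2]}) :
  map_mpoly intr P \mPo [tuple 'X_0 + 'X_1; - ('X_0 * 'X_1)]
    = map_mpoly intr (P \mPo [tuple 'X_0 + 'X_1; - ('X_0 * 'X_1)])
    :> {mpoly algC[2]}.
Proof.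
rewrite map_mpoly_comp; last exact: intr_inj.
congr (_ \mPo _); apply/val_inj => /=.
by rewrite rmorphN rmorphD rmorphM /= !map_mpolyX.
Qed.

Lemma map_intr_inj : injective (map_mpoly intr : {mpoly int[2]} -> {mpoly algC[2]}).
Proof.
move=> p q /mpolyP e; apply/mpolyP => m; have := e m.
by rewrite !mcoeff_map_mpoly => /intr_inj.
Qed.

Lemma lucas_atom_spec_uniq (n : nat) (P Q : {mpoly int[2]}) :
  (0 < n)%N -> lucas_atom_spec n P -> lucas_atom_spec n Q -> P = Q.
Proof.
move=> n_gt0 hP hQ; have [w hw] := C_prim_root_exists n_gt0.
have := hP w hw; rewrite -(hQ w hw) !map_comp2 => /map_intr_inj.
rewrite -2!comp2_neg_esym -mesym2E => /msym_fundamental_un e.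
by rewrite -[P]comp2_neg_id e comp2_neg_id.
Qed.

Definition homog2 (R : comNzRingType) (d : nat) (p : {poly R}) : {mpoly R[2]} :=
  \sum_(i < d.+1) p`_i *: ('X_0 ^+ i * 'X_1 ^+ (d - i)).

Lemma homog2_prod (s : seq algC) :
  homog2 (size s) (\prod_(c <- s) ('X - c%:P))
    = \prod_(c <- s) ('X_0 - c *: 'X_1).
Proof.
elim: s => [|c s IHs]; first by rewrite /homog2 !big_nil big_ord1 coef1 !scale1r mulr1.
rewrite !big_cons -IHs /=; set p := \prod_(j <- s) _; set d := size s.
have szp : size p = d.+1 by rewrite size_prod_XsubC.
rewrite [RHS]mulrBl /homog2.
under eq_bigr => i _ do rewrite mulrBl coefB scalerBl coefCM coefXM.
rewrite sumrB; congr (_ - _).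
  rewrite big_ord_recl /= scale0r add0r mulr_sumr; apply: eq_bigr => i _.
  by rewrite /= /bump /= add1n subSS -scalerAr mulrA -exprS.
rewrite big_ord_recr /= nth_default ?szp // mulr0 scale0r addr0 mulr_sumr.
apply: eq_bigr => i _.
rewrite -scalerAl -scalerAr scalerA; congr (_ *: _).
have id : (i <= d)%N by rewrite -ltnS.
by rewrite (subSn id) exprS mulrCA.
Qed.

Lemma cyclotomicE (w : algC) (n : nat) : (1 < n)%N ->
  cyclotomic w n = \prod_(1 <= j < n.+1 | coprime j n) ('X - (w ^+ j)%:P).
Proof.
move=> n_gt1; have n_gt0 := ltnW n_gt1.
rewrite /cyclotomic -(big_mkord (fun k => coprime k n) (fun k => 'X - (w ^+ k)%:P)).
rewrite [LHS]big_mkcond [RHS]big_mkcond [LHS]big_ltn // [RHS]big_nat_recr //=.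
by rewrite /coprime gcd0n gcdnn gtn_eqF // mulr1 mul1r.
Qed.

Lemma hcyclotomic_int (w : algC) (n : nat) : (1 < n)%N -> n.-primitive_root w ->
  hcyclotomic w n = map_mpoly intr (homog2 (totient n) 'Phi_n).
Proof.
move=> n_gt1 hw.
pose s := [seq w ^+ j | j <- index_iota 1 n.+1 & coprime j n].
have Es : \prod_(c <- s) ('X - c%:P) = cyclotomic w n.
  by rewrite cyclotomicE // /s big_map big_filter.
have -> : hcyclotomic w n = \prod_(c <- s) ('X_0 - c *: 'X_1).
  by rewrite /s big_map big_filter.
have szs : size s = totient n.
  by have := size_cyclotomic w n; rewrite -Es size_prod_XsubC; case.
rewrite -homog2_prod szs Es.
rewrite -(Cintr_Cyclotomic hw) /homog2 raddf_sum /=; apply: eq_bigr => i _.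
by rewrite map_mpolyZ rmorphM !rmorphXn /= !map_mpolyX coef_map.
Qed.

Lemma msym2 (R : comNzRingType) (s : 'S_2) (p : {mpoly R[2]}) :
  msym s p = p \/ msym s p = p \mPo [tuple 'X_1; 'X_0].
Proof.
have E : msym s p = p \mPo [tuple 'X_(s 0); 'X_(s 1)].
  rewrite -[LHS]comp_mpoly_id msym_mPo eq_tuple2; congr (_ \mPo [tuple _; _]);
  by rewrite tnth_mktuple.
rewrite E; have := @perm_inj _ s 0 1.
have H (i : 'I_2) : i = 0 \/ i = 1.
  by case: i => [[|[|//]] ?]; [left|right]; apply/val_inj.
case: (H (s 0)) (H (s 1)) => -> [] -> inj.
- by have := inj (erefl _).
- by left; rewrite -[RHS]comp_mpoly_id eq_tuple2.
- by right.
- by have := inj (erefl _).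
Qed.

Lemma hcyclotomic_swap (w : algC) (n : nat) : (1 < n)%N -> n.-primitive_root w ->
  hcyclotomic w n \mPo [tuple 'X_1; 'X_0] = hcyclotomic w n.
Proof.
move=> n_gt1 hw; have n_gt0 := ltnW n_gt1.
pose e : algC := \prod_(1 <= j < n.+1 | coprime j n) - w ^+ j.
have E : hcyclotomic w n \mPo [tuple 'X_1; 'X_0] = e *: hcyclotomic w n.
  rewrite {1}/hcyclotomic rmorph_prod /=.
  under eq_bigr => j _ do rewrite comp_mpolyB comp_mpolyZ !comp_mpolyXU /=.
  transitivity (\prod_(1 <= j < n.+1 | coprime j n)
     ((- w ^+ j) *: ('X_0 - w ^+ (n - j) *: 'X_1)) : {mpoly algC[2]}).
    rewrite [LHS]big_nat_cond [RHS]big_nat_cond; apply: eq_bigr => j /andP[/andP[j1 jn] _].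
    rewrite scalerBr scalerA mulNr -exprD subnKC // (prim_expr_order hw).
    by rewrite !scaleNr scale1r opprK addrC.
  rewrite scaler_prod; congr (_ *: _); rewrite /hcyclotomic.
  rewrite [LHS]big_mkcond [RHS]big_mkcond /= !(big_nat_recr n) //= !/(coprime n n) gcdnn.
  rewrite (gtn_eqF n_gt1) !mulr1 [LHS]big_nat_rev [RHS]big_nat_cond [LHS]big_nat_cond /=.
  apply: eq_bigr => j /andP[/andP[j1 jn] _]; rewrite add1n subSS.
  rewrite subKn ?(ltnW jn) //; congr (if _ then _ else _).
  rewrite [RHS]coprime_sym /coprime -{2 3}(subnK (ltnW jn)) gcdnDl.
  by rewrite [in RHS]gcdnC gcdnDr gcdnC.
rewrite E; suff -> : e = 1 by rewrite scale1r.
pose v : 'I_2 -> algC := fun=> 1.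
have := congr1 (meval v) E; rewrite comp_mpoly_meval mevalZ.
have -> : (hcyclotomic w n).@[fun i => (tnth [tuple 'X_1; 'X_0] i).@[v]]
   = (hcyclotomic w n).@[v].
  by apply: meval_eq => -[[|[|//]] ?]; rewrite (tnth_nth 0) /= mevalXU.
rewrite -[LHS]mul1r => /mulIf-> //.
rewrite /hcyclotomic rmorph_prod /= prodf_seq_neq0; apply/allP => j _; apply/implyP => jn.
rewrite mevalB mevalZ !mevalXU mulr1 subr_eq0 eq_sym -(prim_order_dvd hw).
apply: contraTN jn => nj; rewrite coprime_sym /coprime (gcdn_idPl nj).
by rewrite gtn_eqF.
Qed.

Lemma lucas_atom_exists (m : nat) : {P : {mpoly int[2]} | lucas_atom_spec m.+2 P}.
Proof.
set n := m.+2; have n_gt1 : (1 < n)%N by [].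
pose F := homog2 (totient n) 'Phi_n.
have [w0 hw0] := C_prim_root_exists (ltnW n_gt1).
have Fsym : F \is symmetric.
  apply/issymP => s; case: (msym2 s F) => -> //; apply: map_intr_inj.
  rewrite map_mpoly_comp; last exact: intr_inj.
  rewrite -(hcyclotomic_int n_gt1 hw0) -[RHS]hcyclotomic_swap //.
  by congr (_ \mPo _); apply/val_inj; rewrite /= !map_mpolyX.
have [t [tF _]] := sym_fundamental Fsym.
exists (t \mPo [tuple 'X_0; - 'X_1]) => w hw.
rewrite map_comp2 hcyclotomic_int //; congr map_mpoly.
by rewrite -comp2_neg_esym comp2_neg_id -mesym2E.
Qed.

(* P_1 is set to 1 by convention rather than by the defining identity; the
   index 0 is meaningless and gets the same value. *)
Definition lucas_atom (n : nat) : {mpoly int[2]} :=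
  if n is m.+2 then sval (lucas_atom_exists m) else 1.

Lemma lucas_atomP (n : nat) : (1 < n)%N -> lucas_atom_spec n (lucas_atom n).
Proof. by case: n => [|[|m]] // _; apply: svalP. Qed.

Definition lucas_atom_val (s t : int) (n : nat) : int :=
  (lucas_atom n).@[tnth [tuple s; t]].

Definition padic_val (p : nat) (x : int) : \bar int :=
  if x == 0 then +oo%E else (Posz (logn p `|x|%N))%:E.

(* Main.v *)
(* Let x, y be the roots of X^2 - s X - t, so that P_n(s, t) is the product of
   the x - z y over the primitive n-th roots of unity z.  Exchanging x and y
   leaves it unchanged, so pairing x - z y with y - z x and using
   s^2 = 3^(b+1) s'^2, t = 3^b t' gives, up to sign,
     P_n^2 = 3^(b phi(n)) W,  W = prod_z (t' (1 + z)^2 + 3 z s'^2).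
   Unless n = 2 * 3^h, each 1 + z divides an integer prime to 3, hence W is
   prime to 3.  If n = 2 * 3^(k+1) and m = 3^k, then P_n = X_k^2 + 3 t^m with
   X_k = x^m + y^m, and X_(k+1) = X_k (X_k^2 + 3 t^m).  By induction
   3^(b m + 1) divides X_k^2, and 3^(b m + 2) does when k > 0, in which case the
   term 3 t^m, of valuation b m + 1, decides the valuation. *)

Require Import Defs.
From mathcomp Require Import all_boot all_order all_algebra all_field.
From mathcomp Require Import mpoly constructive_ereal ring zify.

Import GRing.Theory Num.Theory.
Local Open Scope ring_scope.

(** * Integer values of the atoms as products over primitive roots of unity *)

Lemma meval_map_intr (R : comNzRingType) (k : nat) (v : 'I_k -> int)
    (p : {mpoly int[k]}) :
  (map_mpoly intr p).@[fun i => (v i)%:~R] = (p.@[v])%:~R :> R.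
Proof.
rewrite /map_mpoly /mmap raddf_sum mevalE rmorph_sum; apply: eq_bigr => m _ /=.
rewrite mmap1_id mevalM mevalC mevalX rmorphM rmorph_prod /=; congr (_ * _).
by apply: eq_bigr => i _; rewrite rmorphXn.
Qed.

Definition prim_roots (w : algC) (n : nat) : seq algC :=
  [seq w ^+ j | j <- index_iota 1 n.+1 & coprime j n].

Lemma prim_rootsP (w : algC) (n : nat) : n.-primitive_root w ->
  {in prim_roots w n, forall z, n.-primitive_root z}.
Proof.
move=> hw z /mapP[j]; rewrite mem_filter => /andP[cj _] ->.
by rewrite prim_root_exp_coprime.
Qed.

Lemma prod_prim_roots (w : algC) (n : nat) (F : algC -> algC) :
  \prod_(z <- prim_roots w n) F z
    = \prod_(1 <= j < n.+1 | coprime j n) F (w ^+ j).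
Proof. by rewrite big_map big_filter. Qed.

Lemma prod_prim_roots_XsubC (w : algC) (n : nat) : (1 < n)%N ->
  \prod_(z <- prim_roots w n) ('X - z%:P) = cyclotomic w n.
Proof. by move=> n_gt1; rewrite cyclotomicE // big_map big_filter. Qed.

Lemma size_prim_roots (w : algC) (n : nat) : (1 < n)%N ->
  size (prim_roots w n) = totient n.
Proof.
move=> n_gt1; have := size_cyclotomic w n.
by rewrite -prod_prim_roots_XsubC // size_prod_XsubC => -[].
Qed.

Lemma uniq_prim_roots (w : algC) (n : nat) : (1 < n)%N -> n.-primitive_root w ->
  uniq (prim_roots w n).
Proof.
move=> n_gt1 hw; rewrite map_inj_in_uniq ?filter_uniq ?iota_uniq // => i j.
(* The index [n] lies in the range but is not coprime to itself when [n > 1], so the exponents stay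
   below [n]. *)
have bnd k : k \in [seq j <- index_iota 1 n.+1 | coprime j n] -> (k < n)%N.
  rewrite mem_filter mem_index_iota => /and3P[ck _]; rewrite ltnS leq_eqVlt.
  by case/orP=> // /eqP kn; rewrite kn /coprime gcdnn gtn_eqF in ck.
move=> /bnd i_lt /bnd j_lt /eqP; rewrite (eq_prim_root_expr hw).
by rewrite !modn_small // => /eqP.
Qed.

Lemma lucas_atom_val_prod (s t : int) (n : nat) (w x y : algC) :
  (1 < n)%N -> n.-primitive_root w ->
  x + y = s%:~R -> x * y = - t%:~R ->
  (lucas_atom_val s t n)%:~R = \prod_(z <- prim_roots w n) (x - z * y).
Proof.
move=> n_gt1 hw exs ext.
pose v (i : 'I_2) : algC := if i == 0 then x else y.
have := congr1 (meval v) (lucas_atomP n_gt1 hw).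
rewrite comp_mpoly_meval /hcyclotomic rmorph_prod /= prod_prim_roots.
under [X in _ = X -> _]eq_bigr => j _ do rewrite mevalB mevalZ !mevalXU /=.
move=> <-; rewrite -meval_map_intr; apply: meval_eq => -[[|[|//]] ?];
rewrite !(tnth_nth 0) /=.
- by rewrite mevalD !mevalXU.
- by rewrite mevalN mevalM !mevalXU /v /= ext opprK.
Qed.

Lemma quadratic_roots (s t : int) :
  exists x y : algC, x + y = s%:~R /\ x * y = - t%:~R.
Proof.
pose d : algC := sqrtC (s%:~R ^+ 2 + 4 * t%:~R).
have d2 : d ^+ 2 = s%:~R ^+ 2 + 4 * t%:~R by rewrite sqrtCK.
exists ((s%:~R + d) / 2), ((s%:~R - d) / 2); split; first by field.
have -> : (s%:~R + d) / 2 * ((s%:~R - d) / 2) = (s%:~R ^+ 2 - d ^+ 2) / 4 by field.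
by rewrite d2; field.
Qed.

Lemma lucas_atom_val_sqr (s t : int) (n : nat) (w : algC) :
  (1 < n)%N -> n.-primitive_root w ->
  (lucas_atom_val s t n)%:~R ^+ 2
    = \prod_(z <- prim_roots w n) - (t%:~R * (1 + z) ^+ 2 + z * s%:~R ^+ 2).
Proof.
move=> n_gt1 hw; have [x [y [es et]]] := quadratic_roots s t.
rewrite expr2 {1}(lucas_atom_val_prod _ _ _ _ _ _ n_gt1 hw es et).
(* Only the second copy of the product has its roots exchanged; the paired factors give $(x - zy)(y
   - zx) = xy(1+z)^2 - z(x+y)^2$. *)
rewrite addrC in es; rewrite mulrC in et.
rewrite (lucas_atom_val_prod _ _ _ _ _ _ n_gt1 hw es et) -big_split /=.
apply: eq_bigr => z _; rewrite -es.
have -> : t%:~R = - (y * x) by rewrite et opprK.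
by ring.
Qed.

(** * Divisibility by 3 among algebraic integers *)

Lemma dvdz_Aint (p m : int) (z : algC) : p != 0 ->
  z \in Aint -> m%:~R = p%:~R * z -> (p %| m)%Z.
Proof.
move=> p0 Az e; have pC0 : p%:~R != 0 :> algC by rewrite intr_eq0.
have ez : z = m%:~R / p%:~R by rewrite e mulrAC divff // mul1r.
have : z \is a Num.int.
  by apply: Cint_rat_Aint Az; rewrite ez rpred_div // rpred_int.
case/intrP=> k ek; apply/dvdzP; exists k; apply/(@intr_inj algC).
by rewrite e ek -rmorphM mulrC.
Qed.

(** For an algebraic integer [x] this expresses invertibility modulo 3, since [c] is invertible
    there. It passes to products, and for an ordinary integer it excludes divisibility by 3. *)
Definition Aint_unit_mod3 (x : algC) : Prop :=
  exists (c : int) (g e : algC),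
    [/\ ~~ (3 %| c)%Z, g \in Aint, e \in Aint & x * g = c%:~R + 3 * e].

Lemma Aint_unit_mod3M (x y : algC) :
  Aint_unit_mod3 x -> Aint_unit_mod3 y -> Aint_unit_mod3 (x * y).
Proof.
move=> [c [g [e [c3 Ag Ae E]]]] [c' [g' [e' [c3' Ag' Ae' E']]]].
exists (c * c'), (g * g'), (c%:~R * e' + e * c'%:~R + 3 * e * e'); split.
- by rewrite dvdzE abszM Euclid_dvdM // negb_or -!dvdzE c3.
- by rewrite rpredM.
- by rewrite !rpredD ?rpredM ?rpred_nat ?rpred_int.
by rewrite mulrACA E E' rmorphM /=; ring.
Qed.

Lemma Aint_unit_mod3_ndvd (m : int) : Aint_unit_mod3 m%:~R -> ~~ (3 %| m)%Z.
Proof.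
move=> [c [g [e [c3 Ag Ae E]]]]; apply: contra c3 => /dvdzP[k mk].
apply: (@dvdz_Aint 3 _ (k%:~R * g - e)) => //.
  by rewrite rpredB ?rpredM ?rpred_int.
by rewrite -[LHS](addrK (3 * e)) -E mk rmorphM /=; ring.
Qed.

(** For odd [k], $1 + z^k = 1^k - (-z)^k$, and the cofactor is a geometric sum. *)
Lemma odd_dvd_Aint (z : algC) (k : nat) : z \in Aint -> odd k ->
  exists2 g, g \in Aint & (1 + z) * g = 1 + z ^+ k.
Proof.
move=> Az ok; exists (\sum_(i < k) (- 1) ^+ i * z ^+ i).
  by apply: rpred_sum => i _; rewrite rpredM ?rpredX ?rpredN ?rpred1.
have := subrXX 1 (- z) k; rewrite expr1n exprNn -signr_odd ok expr1 mulN1r !opprK.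
move=> ->; congr *%R; apply: eq_bigr => i _.
by rewrite expr1n mul1r (exprNn z).
Qed.

(** Raising [z] to the 3-part of [n] gives [u], of order [m] prime to 3, and [1 + z] divides
    [1 + u]. If [m] is odd, [1 + u] divides $1 + u^m = 2$. If [m] is even, then $m \ne 2$, and
    [1 + u] divides $1 - u^2$, which divides $m/2$. *)
Lemma add1_prim_root_dvd (n : nat) (z : algC) : (0 < n)%N -> n.-primitive_root z ->
  (forall h, n <> 2 * 3 ^ h)%N ->
  exists c : nat, ~~ (3 %| c)%N /\ exists2 g, g \in Aint & (1 + z) * g = c%:R.
Proof.
move=> n_gt0 hz hn.
have Az : z \in Aint by apply: (Aint_prim_root hz).
have [//|m cm nE] := @pfactor_coprime 3 n _ n_gt0.
have m3 : ~~ (3 %| m)%N by rewrite -prime_coprime.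
set k := logn 3 n in nE.
have m_gt0 : (0 < m)%N by move: n_gt0; rewrite {1}nE muln_gt0 => /andP[].
have hu : m.-primitive_root (z ^+ (3 ^ k)).
  have mn : (m %| n)%N by rewrite nE dvdn_mulr.
  have := dvdn_prim_root hz mn.
  by rewrite {1}nE mulKn.
set u := z ^+ (3 ^ k) in hu *.
have Au : u \in Aint by rewrite rpredX.
have [g0 Ag0 E0] : exists2 g, g \in Aint & (1 + z) * g = 1 + u.
  by apply: odd_dvd_Aint => //; rewrite oddX orbT.
suff [c [c3 [g Ag E]]] : exists c : nat, ~~ (3 %| c)%N /\
    exists2 g, g \in Aint & (1 + u) * g = c%:R.
  by exists c; split=> //; exists (g0 * g); rewrite ?rpredM // mulrA E0.
have [om|em] := boolP (odd m).
  exists 2%N; split=> //; have [g Ag E] := odd_dvd_Aint _ _ Au om.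
  by exists g; rewrite // E (prim_expr_order hu).
have m2 : m = (2 * m./2)%N by rewrite mul2n -[LHS]odd_double_half (negbTE em).
have u2 : u ^+ 2 != 1.
  rewrite -(prim_order_dvd hu); apply: contra_notN (hn k) => /(dvdn_leq _) h.
  by rewrite {1}nE; congr (_ * _)%N; move: (h isT); lia.
exists m./2; split.
  by apply: contra m3 => h; rewrite m2 dvdn_mull.
pose S := \sum_(i < m./2) u ^+ 2 ^+ i.
have S0 : S = 0.
  have := subrX1 (u ^+ 2) m./2; rewrite -exprM -m2 (prim_expr_order hu) subrr.
  by move/esym/eqP; rewrite mulf_eq0 subr_eq0 (negbTE u2) => /eqP.
pose G i := \sum_(j < i) u ^+ 2 ^+ j.
exists ((1 - u) * \sum_(i < m./2) G i).
  rewrite rpredM ?rpredB ?rpred1 //; apply: rpred_sum => i _; apply: rpred_sum => j _.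
  by rewrite !rpredX.
(* As [S] vanishes, $m/2$ is the sum of the $1 - u^{2i}$, each a multiple of $1 - u^2$. *)
have -> : (m./2)%:R = m./2%:R - S by rewrite S0 subr0.
have -> : (m./2)%:R = \sum_(i < m./2) 1 :> algC by rewrite sumr_const card_ord.
rewrite -sumrB mulrA mulr_sumr; apply: eq_bigr => i _.
by rewrite -[in RHS]opprB subrX1 /G -mulNr; congr (_ * _); ring.
Qed.

(** * Indices other than $2 \cdot 3^h$ *)

Lemma prodrMl_seq (R : comNzRingType) (I : Type) (r : seq I) (c : R) (F : I -> R) :
  \prod_(i <- r) (c * F i) = c ^+ size r * \prod_(i <- r) F i.
Proof.
elim: r => [|i r IH]; first by rewrite !big_nil mulr1.
by rewrite !big_cons IH exprS mulrACA.
Qed.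

Lemma lucas_atom_val_sqr_3part (s t s' t' : int) (b n : nat) :
  (1 < n)%N -> (forall h, n <> 2 * 3 ^ h)%N -> ~~ (3 %| t')%Z ->
  s ^+ 2 = 3 ^+ b.+1 * s' ^+ 2 -> t = 3 ^+ b * t' ->
  exists2 W : int, ~~ (3 %| W)%Z
    & lucas_atom_val s t n ^+ 2 = 3 ^+ (b * totient n) * W.
Proof.
move=> n_gt1 hn t3 hs ht; have n_gt0 := ltnW n_gt1.
have [w hw] := C_prim_root_exists n_gt0.
pose f (z : algC) := - (t'%:~R * (1 + z) ^+ 2 + 3 * z * s'%:~R ^+ 2).
have VE : (lucas_atom_val s t n)%:~R ^+ 2
    = 3 ^+ (b * totient n) * \prod_(z <- prim_roots w n) f z.
  rewrite (lucas_atom_val_sqr _ _ _ _ n_gt1 hw) -(size_prim_roots w _ n_gt1).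
  rewrite exprM -prodrMl_seq; apply: eq_bigr => z _.
  rewrite -[s%:~R ^+ 2]rmorphXn hs ht /f !rmorphM !rmorphXn rmorph_nat /= (exprS _ b).
  by ring.
have Az : {in prim_roots w n, forall z, z \in Aint}.
  by move=> z /(prim_rootsP _ _ hw) hz; apply: (Aint_prim_root hz).
have AW : \prod_(z <- prim_roots w n) f z \in Aint.
  rewrite big_seq rpred_prod // => z /Az ?.
  by rewrite rpredN rpredD ?rpredM ?rpredX ?rpredD ?rpred1 ?rpred_int ?rpred_nat.
have p0 : 3 ^+ (b * totient n) != 0 :> algC by rewrite expf_neq0 ?pnatr_eq0.
(* The product is an algebraic integer, and it is rational because it equals $P_n^2 /
   3^{b\varphi(n)}$. *)
have /intrP[W EW] : \prod_(z <- prim_roots w n) f z \is a Num.int.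
  apply: Cint_rat_Aint AW.
  have -> : \prod_(z <- prim_roots w n) f z
      = (lucas_atom_val s t n)%:~R ^+ 2 / 3 ^+ (b * totient n).
    by rewrite VE mulrAC divff // mul1r.
  by rewrite rpred_div ?rpredX ?rpred_int ?rpred_nat.
exists W; last first.
  by apply/(@intr_inj algC); rewrite [RHS]rmorphM !rmorphXn rmorph_nat VE EW.
apply: Aint_unit_mod3_ndvd; rewrite -EW big_seq.
apply: big_ind; first by exists 1, 1, 0; rewrite rpred1 rpred0 mulr0 addr0 mulr1.
  exact: Aint_unit_mod3M.
move=> z zr; have hz := prim_rootsP _ _ hw z zr; have Azz := Az z zr.
have [c [c3 [g Ag E]]] := add1_prim_root_dvd _ _ n_gt0 hz hn.
(* Multiplying [f z] by $g^2$ turns $(1+z)^2$ into $c^2$; the remaining term is a multiple of 3. *)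
exists (- (c%:Z ^+ 2 * t')), (g ^+ 2), (- (z * s'%:~R ^+ 2 * g ^+ 2)); split.
- by rewrite dvdzE abszN abszM abszX Euclid_dvdM // Euclid_dvdX // negb_or negb_and c3.
- by rewrite rpredX.
- by rewrite rpredN ?rpredM ?rpredX ?rpred_int.
have Ec : (c%:Z)%:~R = (1 + z) * g by rewrite E.
by rewrite rmorphN rmorphM rmorphXn /= Ec /f; ring.
Qed.

(** * Indices $2 \cdot 3^{k+1}$ *)

Lemma prim6_root (u : algC) : 6.-primitive_root u -> u ^+ 2 - u + 1 = 0.
Proof.
move=> hu; have ne i : ~~ (6 %| i)%N -> u ^+ i != 1 by rewrite (prim_order_dvd hu).
have /eqP := prim_expr_order hu; rewrite -subr_eq0.
have -> : u ^+ 6 - 1 = (u ^+ 3 - 1) * (u + 1) * (u ^+ 2 - u + 1) by ring.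
rewrite !mulf_eq0 subr_eq0 (negbTE (ne 3 _)) //=.
suff /negbTE -> : u + 1 != 0 by move/eqP.
by rewrite addr_eq0; apply: contra (ne 2 isT) => /eqP ->; rewrite sqrrN expr1n.
Qed.

(** With $m = 3^k$ the cyclotomic polynomial is $\Phi_6(X^m) = X^{2m} - X^m + 1$, whose
    homogenization $x^{2m} - x^m y^m + y^{2m}$ is the right-hand side. *)
Lemma prod_prim_roots_2_3X (k : nat) (w x y : algC) :
  (2 * 3 ^ k.+1).-primitive_root w -> y != 0 ->
  \prod_(z <- prim_roots w (2 * 3 ^ k.+1)) (x - z * y)
    = (x ^+ (3 ^ k) + y ^+ (3 ^ k)) ^+ 2 - 3 * (x * y) ^+ (3 ^ k).
Proof.
set n := (2 * 3 ^ k.+1)%N; set m := (3 ^ k)%N; move=> hw y0.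
have nE : n = (6 * m)%N by rewrite /n expnS mulnA.
have m_gt0 : (0 < m)%N by rewrite expn_gt0.
have n_gt1 : (1 < n)%N by rewrite nE; lia.
have tn : totient n = (2 * m)%N.
  by rewrite totient_coprime ?coprimeXr // totient_pfactor // mul1n.
pose p : {poly algC} := 'X^(2 * m) - 'X^m + 1.
have lt_sz : (size (- 'X^m + 1 : {poly algC})%R < size ('X^(2 * m) : {poly algC})%R)%N.
  rewrite size_polyXn ltnS (leq_trans (size_polyD _ _)) // geq_max.
  by rewrite size_polyN size_polyXn size_poly1; apply/andP; split; lia.
have szp : size p = (2 * m).+1 by rewrite /p -addrA size_polyDl // size_polyXn.
have lp : lead_coef p = 1 by rewrite /p -addrA lead_coefDl // lead_coefXn.
(* [p] is monic of degree $2m = \varphi(n)$ and vanishes at every primitive root [z], because $z^m$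
   has order 6. *)
have pE : p = \prod_(z <- prim_roots w n) ('X - z%:P).
  rewrite -[RHS]scale1r -lp; apply: all_roots_prod_XsubC.
  - by rewrite szp size_prim_roots // tn.
  - apply/allP => z /(prim_rootsP _ _ hw) hz; apply/rootP.
    rewrite /p !hornerE mulnC exprM; apply: prim6_root.
    have mn : (6 %| n)%N by rewrite nE dvdn_mulr.
    by have := dvdn_prim_root hz mn; rewrite nE mulKn.
  - by rewrite uniq_rootsE; apply: uniq_prim_roots.
have -> : \prod_(z <- prim_roots w n) (x - z * y) = y ^+ (2 * m) * p.[x / y].
  rewrite pE horner_prod -tn -(size_prim_roots w _ n_gt1) -prodrMl_seq.
  apply: eq_bigr => z _; rewrite hornerXsubC mulrBr.
  by rewrite mulrCA divff // mulr1 [y * z]mulrC.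
rewrite /p !hornerE (mulnC 2) !exprM !expr_div_n exprMn.
have : y ^+ m != 0 by rewrite expf_neq0.
by move=> ?; field.
Qed.

(** [X] is the term of index $3^k$ of the companion Lucas sequence. Its square is bounded because
    $X^2$ is what gets compared with $3t^{3^k}$; the boolean [0 < k] counts a factor 3 gained after
    the initial term. *)
Lemma companion_lucas_3X (s t s' t' : int) (b k : nat) (x y : algC) :
  s ^+ 2 = 3 ^+ b.+1 * s' ^+ 2 -> t = 3 ^+ b * t' ->
  x + y = s%:~R -> x * y = - t%:~R ->
  exists X q : int, x ^+ (3 ^ k) + y ^+ (3 ^ k) = X%:~R
    /\ X ^+ 2 = 3 ^+ (b * 3 ^ k + (0 < k)).+1 * q.
Proof.
move=> hs ht es et; elim: k => [|k [X [q [EX Eq]]]].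
  by exists s, (s' ^+ 2); rewrite !expr1 es hs muln1 addn0.
set m := (3 ^ k)%N in EX Eq *.
have om : odd m by rewrite oddX orbT.
(* The square of $X(X^2 + 3t^m)$ carries $3^{3(bm+1)}$, one factor 3 more than claimed; that factor
   stays in the witness. *)
exists (X ^+ 3 + 3 * t ^+ m * X),
  (3 * q * 3 ^+ (0 < k) * (q * 3 ^+ (0 < k) + t' ^+ m) ^+ 2); split.
  rewrite expnS mulnC !exprM -/m rmorphD !rmorphM !rmorphXn rmorph_nat /= -EX.
  have -> : t%:~R ^+ m = - (x ^+ m * y ^+ m) :> algC.
    by rewrite -exprMn et exprNn -signr_odd om expr1 mulN1r opprK.
  by ring.
have Eq' : X ^+ 2 = 3 ^+ (b * m).+1 * (q * 3 ^+ (0 < k)).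
  by rewrite Eq -addSn exprD; ring.
have -> : X ^+ 3 + 3 * t ^+ m * X = X * (X ^+ 2 + 3 * t ^+ m) by ring.
rewrite exprMn Eq' ht exprMn -exprM expnS -/m.
have -> : (b * (3 * m) + (0 < k.+1)).+1 = (b * m + b * m + b * m + 2)%N by lia.
by rewrite !exprD !exprS expr0; ring.
Qed.

(** * Valuations and the case analysis *)

Lemma padic_val_ndvd (p : nat) (m : int) : ~~ (p %| m)%Z -> padic_val p m = 0%:E.
Proof.
move=> pm; rewrite /padic_val; case: eqP pm => [-> |_]; first by rewrite dvdz0.
by rewrite dvdzE => pm; rewrite lognE (negbTE pm) !andbF.
Qed.

(** Both sides are [+oo] when [m = 0], a case that occurs for [n = 6] if $s'^2 + t' = 0$. *)
Lemma padic_valM (p e : nat) (m : int) : prime p ->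
  padic_val p (p%:Z ^+ e * m) = (e%:Z%:E + padic_val p m)%E.
Proof.
move=> pp; have p_gt0 := prime_gt0 pp.
have p0 : p%:Z ^+ e != 0 by rewrite expf_neq0 // -lt0n.
rewrite /padic_val mulf_eq0 (negbTE p0) /=; case: eqP => // /eqP m0.
rewrite abszM abszX lognM ?expn_gt0 ?p_gt0 ?absz_gt0 //.
by rewrite pfactorK.
Qed.

Lemma lucas_atom_val2 (s t : int) : lucas_atom_val s t 2 = s.
Proof.
have [w hw] := C_prim_root_exists (isT : 0 < 2)%N.
have [x [y [es et]]] := quadratic_roots s t.
have w1 : w = -1.
  have w_neq1 : w - 1 != 0 by rewrite subr_eq0 -[w]expr1 -(prim_order_dvd hw).
  have /eqP := prim_expr_order hw; rewrite -subr_eq0 subr_sqr_1 mulf_eq0.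
  by rewrite (negbTE w_neq1) addr_eq0 => /eqP.
apply/(@intr_inj algC); rewrite (lucas_atom_val_prod _ _ _ _ _ _ _ hw es et) //.
by rewrite /prim_roots /= big_seq1 expr1 w1 -es mulN1r opprK.
Qed.

Lemma lucas_atom_val_2_3X (s t : int) (k : nat) (x y : algC) :
  t != 0 -> x + y = s%:~R -> x * y = - t%:~R ->
  (lucas_atom_val s t (2 * 3 ^ k.+1))%:~R
    = (x ^+ (3 ^ k) + y ^+ (3 ^ k)) ^+ 2 + 3 * t%:~R ^+ (3 ^ k).
Proof.
move=> t0 es et; set n := (2 * 3 ^ k.+1)%N.
have n_gt1 : (1 < n)%N by rewrite /n; have := expn_gt0 3 k.+1; lia.
have [w hw] := C_prim_root_exists (ltnW n_gt1).
have y0 : y != 0.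
  apply: contraNneq t0 => y0; move/eqP: et; rewrite y0 mulr0 eq_sym oppr_eq0.
  by rewrite intr_eq0.
rewrite (lucas_atom_val_prod _ _ _ _ _ _ n_gt1 hw es et) prod_prim_roots_2_3X //.
by rewrite et exprNn -signr_odd oddX orbT expr1 mulN1r mulrN opprK.
Qed.

(* For n >= 3 the totient of n is even, so that the halving ./2 is exact. *)
Theorem theorem18 (s t s' t' : int) (a b : nat)
    (ha : (0 < a)%N) (hb : (0 < b)%N)
    (hs : s = 3 ^+ a * s') (ht : t = 3 ^+ b * t')
    (hs't' : ~~ (3 %| s' * t')%Z) (hab : b = (2 * a - 1)%N)
    (n : nat) (hn : (2 <= n)%N) :
  [/\ n = 2%N -> padic_val 3 (lucas_atom_val s t n) = a%:Z%:E,
      n = 6%N -> padic_val 3 (lucas_atom_val s t n)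
                   = (b%:Z%:E + 1%:E + padic_val 3 (s' ^+ 2 + t'))%E,
      forall h : nat, (2 <= h)%N -> n = (2 * 3 ^ h)%N ->
        padic_val 3 (lucas_atom_val s t n) = (3 ^ (h - 1) * b + 1)%N%:Z%:E
    & n <> 2%N -> n <> 6%N ->
      ~ (exists h : nat, (2 <= h)%N /\ n = (2 * 3 ^ h)%N) ->
        padic_val 3 (lucas_atom_val s t n) = (b * (totient n)./2)%N%:Z%:E].
Proof.
have [s3 t3] : ~~ (3 %| s')%Z /\ ~~ (3 %| t')%Z.
  by apply/andP; rewrite -negb_or !dvdzE -Euclid_dvdM // -abszM -dvdzE.
have t0 : t != 0.
  rewrite ht mulf_neq0 ?expf_neq0 //; apply: contraNneq t3 => ->.
  exact: dvdz0.
have hs2 : s ^+ 2 = 3 ^+ b.+1 * s' ^+ 2.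
  by rewrite hs exprMn -exprM; congr (3 ^+ _ * _); lia.
have [x [y [es et]]] := quadratic_roots s t.
split.
- by move=> ->; rewrite lucas_atom_val2 hs padic_valM // padic_val_ndvd // adde0.
- move=> ->.
  (* Both terms of $P_6 = s^2 + 3t$ have valuation [b + 1], so further cancellation is possible. *)
  have -> : lucas_atom_val s t 6 = 3 ^+ b.+1 * (s' ^+ 2 + t').
    apply/(@intr_inj algC); rewrite (lucas_atom_val_2_3X _ _ 0 _ _ t0 es et) !expr1 es.
    rewrite -[s%:~R ^+ 2]rmorphXn hs2 ht !(rmorphM, rmorphD) !rmorphXn.
    by rewrite rmorph_nat /= exprS; ring.
  by rewrite padic_valM // -addn1.
- case=> // h h_gt0 ->; rewrite subn1 /=.
  (* This [h] is one less than in the statement, and positive, so $X^2$ has at least one factor 3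
     more than $3t^{3^h}$. *)
  have [X [q [EX Eq]]] := companion_lucas_3X _ _ _ _ _ h _ _ hs2 ht es et.
  rewrite ltnS in h_gt0; rewrite h_gt0 in Eq.
  have -> : lucas_atom_val s t (2 * 3 ^ h.+1)
      = 3 ^+ (3 ^ h * b + 1) * (t' ^+ (3 ^ h) + 3 * q).
    apply/(@intr_inj algC).
    rewrite (lucas_atom_val_2_3X _ _ h _ _ t0 es et) EX -rmorphXn Eq ht /=.
    rewrite !(rmorphM, rmorphD) !rmorphXn rmorph_nat /= exprMn -exprM mulnC.
    by rewrite addn1 !exprS; ring.
  rewrite padic_valM // padic_val_ndvd ?adde0 //.
  rewrite dvdzE -dvdzE rpredDr ?dvdz_mulr // dvdzE abszX Euclid_dvdX //.
  by rewrite negb_and -dvdzE t3.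
move=> n2 n6 nh.
have nh' h : n <> (2 * 3 ^ h)%N.
  by case: h => [|[|h]] // e; apply: nh; exists h.+2.
have [W W3 EW] := lucas_atom_val_sqr_3part _ _ _ _ _ _ hn nh' t3 hs2 ht.
set V := lucas_atom_val s t n in EW *.
have W0 : W != 0 by apply: contraNneq W3 => ->; apply: dvdz0.
have V0 : V != 0.
  have : V ^+ 2 != 0 by rewrite EW mulf_neq0 ?expf_neq0.
  by rewrite sqrf_eq0.
have : (2 * logn 3 `|V|)%N = (b * totient n)%N.
  rewrite -lognX -abszX EW abszM abszX lognM ?expn_gt0 ?absz_gt0 // pfactorK //.
  by rewrite dvdzE in W3; rewrite lognE (negbTE W3) !andbF addn0.
rewrite /padic_val (negbTE V0) => e; congr (_%:Z%:E).
(* The evenness of $\varphi(n)$ is read off the equality [e], since $b = 2a - 1$ is odd. *)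
have even_tot : ~~ odd (totient n).
  have : ~~ odd (b * totient n) by rewrite -e oddM.
  by rewrite oddM; have -> : odd b by lia.
by rewrite -(odd_double_half (totient n)) (negbTE even_tot) in e; lia.
Qed.
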